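(* The index $I_{CD}$ is strongly upper bounded: for all $m\ge 2$, all pairwise comparison matrices $\mathbf{A}_1,\ldots,\mathbf{A}_m\in\mathcal{A}$ of the same order and all $\boldsymbol{\lambda}\in\mathcal{L}_m$, $$I_{CD}(\mathbf{A}^{\star})\le \sum_{h=1}^m\lambda_h\, I_{CD}(\mathbf{A}_h).$$
   Context: A pairwise comparison matrix of order $n$ is a real $n\times n$ matrix $\mathbf{A}=(a_{ij})$ with $a_{ij}>0$ and $a_{ij}a_{ji}=1$ for all $i,j$. $\mathcal{A}$ is the set of all pairwise comparison matrices of all orders $n>2$. $\mathcal{L}_m=\{(\lambda_1,\ldots,\lambda_m): \lambda_h\ge 0\ \forall h,\ \sum_{h=1}^m\lambda_h=1\}$. Given $\mathbf{A}_h=(a_{ij}^{(h)})_{n\times n}\in\mathcal{A}$, $h=1,\ldots,m$ (same order $n$), and $\boldsymbol{\lambda}\in\mathcal{L}_m$, the aggregated matrix $\mathbf{A}^{\star}=(a_{ij}^{\star})_{n\times n}$ is $a_{ij}^{\star}=\prod_{h=1}^m (a_{ij}^{(h)})^{\lambda_h}$. For $\mathbf{A}\in\mathcal{A}$ of order $n$, $$I_{CD}(\mathbf{A})=\prod_{i=1}^{n-2}\prod_{j=i+1}^{n-1}\prod_{k=j+1}^{n}\left(\max\left\{\frac{a_{ij}a_{jk}}{a_{ik}},\frac{a_{ik}}{a_{ij}a_{jk}}\right\}\right)^{1/\binom{n}{3}}.$$ *)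

(* Defs.v *)
From HB Require Import structures.
From mathcomp Require Import all_boot all_order all_algebra.
From mathcomp Require Import all_classical all_reals all_analysis.
Set Implicit Arguments.
Unset Strict Implicit.
Unset Printing Implicit Defensive.
Import Order.TTheory GRing.Theory Num.Theory.
Local Open Scope ring_scope.

(* The requirement 2 < n is part of the definition of the set of all pairwise
   comparison matrices of all orders n > 2. *)
Definition pairwise_comparison_matrix (R : realType) (n : nat) (A : 'M[R]_n)
    : Prop :=
  [/\ (2 < n)%N, (forall i j, 0 < A i j) & (forall i j, A i j * A j i = 1)].

Definition weight_vector (R : realType) (m : nat) (lambda : 'I_m -> R) : Prop :=
  (forall h, 0 <= lambda h) /\ \sum_(h < m) lambda h = 1.

Definition aggregated_matrix (R : realType) (m n : nat)
    (A : 'I_m -> 'M[R]_n) (lambda : 'I_m -> R) : 'M[R]_n :=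
  \matrix_(i, j) \prod_(h < m) (A h i j `^ lambda h).

(* The product over all triples i < j < k of indices; the bounds on i and j
   that leave room for j and k are implied by the two inequalities. *)
Definition I_CD (R : realType) (n : nat) (A : 'M[R]_n) : R :=
  \prod_(i < n) \prod_(j < n | (i < j)%N) \prod_(k < n | (j < k)%N)
    (Num.max (A i j * A j k / A i k) (A i k / (A i j * A j k))
       `^ (('C(n, 3))%:R)^-1).

(* An index is a family of functions, one for each order n; only its values
   at pairwise comparison matrices matter. *)
Definition strongly_upper_bounded (R : realType)
    (I : forall n : nat, 'M[R]_n -> R) : Prop :=
  forall (m n : nat) (A : 'I_m -> 'M[R]_n) (lambda : 'I_m -> R),
    (2 <= m)%N ->
    (forall h, pairwise_comparison_matrix (A h)) ->
    weight_vector lambda ->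
    I n (aggregated_matrix A lambda) <= \sum_(h < m) lambda h * I n (A h).

(* Main.v *)
(* Every factor max(x, 1/x) of I_CD of the aggregated matrix is at most the
   weighted geometric mean of the corresponding factors of the A_h, because x
   itself is the weighted geometric mean of the ratios of the A_h.  Hence I_CD
   of the aggregated matrix is at most the weighted geometric mean of the
   I_CD (A_h), and weighted AM-GM finishes. *)
Require Import Defs.
From mathcomp Require Import all_boot all_order all_algebra.
From mathcomp Require Import all_classical all_reals all_analysis.

Set Implicit Arguments.
Unset Strict Implicit.
Import Order.TTheory GRing.Theory Num.Theory.
Local Open Scope ring_scope.

Lemma powR_prod (R : realType) (I : Type) (r : seq I) (P : pred I)
    (F : I -> R) (a : R) :
  (forall i, P i -> 0 <= F i) ->
  (\prod_(i <- r | P i) F i) `^ a = \prod_(i <- r | P i) F i `^ a.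
Proof.
(* [powRM] needs nonnegative factors, so the induction carries the sign of the partial product along
   with the identity. *)
move=> F0; pose K (x y : R) := 0 <= x /\ x `^ a = y.
suff [] : K (\prod_(i <- r | P i) F i) (\prod_(i <- r | P i) F i `^ a) by [].
apply: (big_rec2 K) => [|i y x Pi [y0 <-]]; first by rewrite /K powR1.
by split; rewrite ?mulr_ge0 ?F0 // powRM ?F0.
Qed.

Lemma weighted_AM_GM (R : realType) (I : finType) (x w : I -> R) :
  (forall i, 0 < x i) -> (forall i, 0 <= w i) -> \sum_i w i = 1 ->
  \prod_i x i `^ w i <= \sum_i w i * x i.
Proof.
move=> x0 w0 w1; pose L := \sum_i w i * ln (x i).
have -> : \prod_i x i `^ w i = expR L.
  by rewrite expR_sum; apply: eq_bigr => i _; rewrite /powR gt_eqF.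
(* The tangent line of [expR] at [L], evaluated at [ln (x i)]. *)
have tangent i : expR L * (1 + (ln (x i) - L)) <= x i.
  have xE : expR L * expR (ln (x i) - L) = x i.
    by rewrite -expRD addrC subrK lnK ?posrE.
  by rewrite -[leRHS]xE ler_pM2l ?expR_gt0 // expR_ge1Dx.
(* The weights sum to 1 and [L] is the weighted mean of the [ln (x i)], so the deviations
   [ln (x i) - L] average to zero. *)
have -> : expR L = \sum_i w i * (expR L * (1 + (ln (x i) - L))).
  under eq_bigr do rewrite mulrCA mulrDr mulr1 mulrBr.
  by rewrite -mulr_sumr big_split sumrB /= -mulr_suml w1 mul1r subrr addr0 mulr1.
by apply: ler_sum => i _; apply: ler_wpM2l.
Qed.

Definition triad (R : realType) (n : nat) (A : 'M[R]_n) (i j k : 'I_n) : R :=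
  Num.max (A i j * A j k / A i k) (A i k / (A i j * A j k)).

Lemma triad_gt0 (R : realType) (n : nat) (A : 'M[R]_n) (i j k : 'I_n) :
  (forall i j, 0 < A i j) -> 0 < triad A i j k.
Proof. by move=> A0; rewrite /triad lt_max divr_gt0 // mulr_gt0. Qed.

(** Strict positivity lets [weighted_AM_GM], which takes logarithms, be applied to the values of the
    index. *)
Lemma I_CD_gt0 (R : realType) (n : nat) (A : 'M[R]_n) :
  (forall i j, 0 < A i j) -> 0 < I_CD A.
Proof.
move=> A0; do 3![apply: prodr_gt0 => ? _].
by rewrite powR_gt0 ?triad_gt0.
Qed.

Lemma I_CD_powR (R : realType) (n : nat) (A : 'M[R]_n) (a : R) :
  I_CD A `^ a =
  \prod_(i < n) \prod_(j < n | (i < j)%N) \prod_(k < n | (j < k)%N)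
    (triad A i j k `^ ('C(n, 3)%:R)^-1) `^ a.
Proof.
rewrite powR_prod => [|i _]; last first.
  by do 2![apply: prodr_ge0 => ? _]; exact: powR_ge0.
apply: eq_bigr => i _; rewrite powR_prod => [|j _]; last first.
  by apply: prodr_ge0 => ? _; exact: powR_ge0.
by apply: eq_bigr => j _; rewrite powR_prod // => k _; exact: powR_ge0.
Qed.

Lemma triad_aggregated (R : realType) (m n : nat) (A : 'I_m -> 'M[R]_n)
    (w : 'I_m -> R) (i j k : 'I_n) :
  (forall h i j, 0 < A h i j) -> (forall h, 0 <= w h) ->
  triad (aggregated_matrix A w) i j k <= \prod_h triad (A h) i j k `^ w h.
Proof.
move=> A0 w0.
have powR_div (x y a : R) : 0 <= x -> 0 < y -> (x / y) `^ a = x `^ a / y `^ a.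
  move=> x0 y0; rewrite powRM ?invr_ge0 ?(ltW y0) //.
  by rewrite -(powR_inv1 (ltW y0)) -powRrM mulN1r powRN.
(* Serves both arguments of the maximum: the second one exchanges the roles of [x] and [y]. *)
have ratio_le (x y t : 'I_m -> R) :
    (forall h, 0 < x h) -> (forall h, 0 < y h) -> (forall h, x h / y h <= t h) ->
    (\prod_h x h `^ w h) / (\prod_h y h `^ w h) <= \prod_h t h `^ w h.
  move=> x0 y0 le_t; rewrite -prodf_div; apply: ler_prod => h _.
  have xy0 : 0 <= x h / y h by rewrite divr_ge0 // ltW.
  rewrite -(powR_div _ _ _ (ltW (x0 h)) (y0 h)) powR_ge0 /=.
  rewrite ge0_ler_powR ?nnegrE //; exact: le_trans xy0 (le_t h).
have AA0 h : 0 < A h i j * A h j k by rewrite mulr_gt0.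
have AAE : (\prod_h A h i j `^ w h) * (\prod_h A h j k `^ w h) =
    \prod_h (A h i j * A h j k) `^ w h.
  by rewrite -big_split; apply: eq_bigr => h _; rewrite powRM // ltW.
rewrite {1}/triad !mxE AAE ge_max !ratio_le // => h;
  by rewrite /triad le_max lexx ?orbT.
Qed.

Lemma I_CD_aggregated (R : realType) (m n : nat) (A : 'I_m -> 'M[R]_n)
    (w : 'I_m -> R) :
  (forall h i j, 0 < A h i j) -> (forall h, 0 <= w h) ->
  I_CD (aggregated_matrix A w) <= \prod_h I_CD (A h) `^ w h.
Proof.
move=> A0 w0.
have As0 i j : 0 < aggregated_matrix A w i j.
  by rewrite mxE prodr_gt0 // => h _; rewrite powR_gt0.
(* Moving the product over [h] inside the products over triples, and swapping the two exponents,
   allows a comparison factor by factor. *)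
have -> : \prod_h I_CD (A h) `^ w h =
  \prod_(i < n) \prod_(j < n | (i < j)%N) \prod_(k < n | (j < k)%N)
    (\prod_h triad (A h) i j k `^ w h) `^ ('C(n, 3)%:R)^-1.
  under eq_bigr => h _ do rewrite I_CD_powR //.
  rewrite exchange_big; apply: eq_bigr => i _.
  rewrite exchange_big; apply: eq_bigr => j _.
  rewrite exchange_big; apply: eq_bigr => k _.
  rewrite powR_prod => [|h _]; last exact: powR_ge0.
  by apply: eq_bigr => h _; rewrite -!powRrM mulrC.
(* Termwise comparison of products needs a nonnegative smaller side at each of the three levels. *)
have le3 (F G : 'I_n -> 'I_n -> 'I_n -> R) :
  (forall i j k, 0 <= F i j k <= G i j k) ->
  \prod_(i < n) \prod_(j < n | (i < j)%N) \prod_(k < n | (j < k)%N) F i j k <=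
  \prod_(i < n) \prod_(j < n | (i < j)%N) \prod_(k < n | (j < k)%N) G i j k.
  move=> FG; have F0 i j k : 0 <= F i j k by case/andP: (FG i j k).
  apply: ler_prod => i _; apply/andP; split.
    by do 2![apply: prodr_ge0 => ? _]; exact: F0.
  apply: ler_prod => j _; apply/andP; split.
    by apply: prodr_ge0 => ? _; exact: F0.
  by apply: ler_prod.
apply: le3 => i j k; rewrite powR_ge0 /= ge0_ler_powR ?invr_ge0 ?nnegrE //.
- by rewrite ltW ?triad_gt0.
- by apply: prodr_ge0 => h _; exact: powR_ge0.
- exact: triad_aggregated.
Qed.

Theorem proposition5 (R : realType) : strongly_upper_bounded (@I_CD R).
Proof.
move=> m n A w _ pcA [w0 w1].
have A0 h i j : 0 < A h i j by case: (pcA h).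
apply: le_trans (I_CD_aggregated A0 w0) _.
by apply: weighted_AM_GM => // h; exact: I_CD_gt0.
Qed.
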